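(* Consider a Herglotz optimal control problem in local coordinates $(x^i,u^a,z)$, given by smooth functions $X^i(x,u,z)$ ($i=1,\dots,n$; the control equations being $\dot x^i=X^i(x,u,z)$) and a smooth function $F(x,u,z)$ (the action equation being $\dot z=F(x,u,z)$). View it as a vakonomic Herglotz problem with configuration variables $(x^i,u^a)$, Lagrangian $L(x,u,\dot x,\dot u,z)=F(x,u,z)$, constraints $\psi^i=X^i(x,u,z)-\dot x^i$, and extended Lagrangian $$\mathcal{L}(x,u,\mu,\dot x,\dot u,\dot\mu,z)=F(x,u,z)-\mu_i\left(X^i(x,u,z)-\dot x^i\right)$$ (summation over repeated indices). Then a smooth curve $t\mapsto(x(t),u(t),\mu(t),z(t))$ satisfies the Herglotz equations for $\mathcal{L}$ (with respect to the configuration variables $x^i,u^a,\mu_i$) together with $\dot z=\mathcal{L}$ if and only if it satisfies $$\dot x^i=X^i,$$ $$\dot\mu_i=\mu_i\frac{\partial F}{\partial z}-\mu_j\frac{\partial X^j}{\partial x^i}+\frac{\partial F}{\partial x^i}-\frac{\partial X^j}{\partial z}\mu_i\mu_j,$$ $$\dot z=F,$$ subject to the constraints $$\frac{\partial F}{\partial u^a}-\mu_j\frac{\partial X^j}{\partial u^a}=0\quad\text{for all } a.$$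
   Context: For a Lagrangian $\mathcal{L}(y,\dot y,z)$ with configuration variables $y=(y^A)$, the Herglotz equations along a curve $(y(t),z(t))$ are $$\frac{\mathrm{d}}{\mathrm{d}t}\frac{\partial\mathcal{L}}{\partial\dot y^A}-\frac{\partial\mathcal{L}}{\partial y^A}=\frac{\partial\mathcal{L}}{\partial\dot y^A}\frac{\partial\mathcal{L}}{\partial z}\quad\text{for all } A,$$ with derivatives evaluated along $(y(t),\dot y(t),z(t))$. The Herglotz optimal control problem: given $x_a,x_b$ and $z_0$, find curves $(x(t),u(t),z(t))$, $t\in[a,b]$, with $x(a)=x_a$, $x(b)=x_b$, $z(a)=z_0$, $\dot x=X(x,u,z)$ and $\dot z=F(x,u,z)$, for which $z(b)$ is maximal. The $x^i$ are the state variables, the $u^a$ the controls and $z$ the action. *)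

(* Defs.v *)
From HB Require Import structures.
From mathcomp Require Import all_boot all_order all_algebra.
From mathcomp Require Import all_classical all_reals all_analysis.

Set Implicit Arguments.
Unset Strict Implicit.
Unset Printing Implicit Defensive.

Import Order.TTheory GRing.Theory Num.Theory.
Import numFieldNormedType.Exports.

Local Open Scope classical_set_scope.
Local Open Scope ring_scope.

(* In finite dimension and for U open, a function is of class C^(r+1) on U iff
   it is differentiable on U with all its directional derivatives of class C^r
   there. *)
Fixpoint class_C (R : realType) (V W : normedModType R) (r : nat)
    (U : set V) (f : V -> W) {struct r} : Prop :=
  if r is r'.+1 then
    (forall p, U p -> differentiable f p) /\
    (forall v : V, class_C r' U ('D_v f))
  else forall p, U p -> {for p, continuous f}.

Definition smooth_on (R : realType) (V W : normedModType R)
    (U : set V) (f : V -> W) : Prop :=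
  forall r, class_C r U f.

(* Smoothness on an interval which need not be open means smoothness on an open
   neighbourhood of it; the derivative at an endpoint in I is then the
   one-sided derivative of the restriction to I. *)
Definition smooth_curve (R : realType) (V : normedModType R)
    (I : interval R) (c : R -> V) : Prop :=
  exists O : set R, [/\ open O, [set` I] `<=` O & smooth_on O c].

Definition partial (R : realType) (m : nat) (A : 'I_m)
    (f : 'rV[R]_m -> R) (q : 'rV[R]_m) : R :=
  'D_(delta_mx 0 A) f q.

(* Lagrangians L(y, ydot, z), with y = (y^A) a row vector. *)
Definition lagrangian (R : realType) (m : nat) : Type :=
  'rV[R]_m -> 'rV[R]_m -> R -> R.

Definition momentum (R : realType) (m : nat) (L : lagrangian R m)
    (y : R -> 'rV[R]_m) (z : R -> R) (A : 'I_m) (t : R) : R :=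
  partial A (fun v => L (y t) v (z t)) (derive1 y t).

Definition herglotz_equations (R : realType) (m : nat) (L : lagrangian R m)
    (y : R -> 'rV[R]_m) (z : R -> R) (t : R) : Prop :=
  forall A : 'I_m,
    derive1 (momentum L y z A) t
      - partial A (fun q => L q (derive1 y t) (z t)) (y t)
    = momentum L y z A t * derive1 (fun s => L (y t) (derive1 y t) s) (z t).

(* The configuration variables of the extended Lagrangian are (q, mu), stored
   as row_mx q mu; it does not depend on mudot. *)
Definition extended_lagrangian (R : realType) (m p : nat) (L : lagrangian R m)
    (psi : 'rV[R]_m -> 'rV[R]_m -> R -> 'rV[R]_p) : lagrangian R (m + p) :=
  fun y v z =>
    L (lsubmx y) (lsubmx v) z
      - \sum_(i < p) rsubmx y 0 i * psi (lsubmx y) (lsubmx v) z 0 i.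

Notation control_space R n k := ('rV[R]_n * 'rV[R]_k * R)%type.

(* A control problem is vakonomic with q = (x, u), stored as row_mx x u. *)
Definition control_lagrangian (R : realType) (n k : nat)
    (F : control_space R n k -> R) : lagrangian R (n + k) :=
  fun q v z => F (lsubmx q, rsubmx q, z).

Definition control_constraint (R : realType) (n k : nat)
    (X : control_space R n k -> 'rV[R]_n) :
    'rV[R]_(n + k) -> 'rV[R]_(n + k) -> R -> 'rV[R]_n :=
  fun q v z => X (lsubmx q, rsubmx q, z) - lsubmx v.

Definition control_extended_lagrangian (R : realType) (n k : nat)
    (X : control_space R n k -> 'rV[R]_n) (F : control_space R n k -> R) :
    lagrangian R (n + k + n) :=
  extended_lagrangian (control_lagrangian F) (control_constraint X).

Definition extended_curve (R : realType) (n k : nat) (x : R -> 'rV[R]_n)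
    (u : R -> 'rV[R]_k) (mu : R -> 'rV[R]_n) : R -> 'rV[R]_(n + k + n) :=
  fun t => row_mx (row_mx (x t) (u t)) (mu t).

Definition dx (R : realType) (n k : nat) (i : 'I_n)
    (G : control_space R n k -> R) (p : control_space R n k) : R :=
  partial i (fun x => G (x, p.1.2, p.2)) p.1.1.

Definition du (R : realType) (n k : nat) (a : 'I_k)
    (G : control_space R n k -> R) (p : control_space R n k) : R :=
  partial a (fun u => G (p.1.1, u, p.2)) p.1.2.

Definition dz (R : realType) (n k : nat)
    (G : control_space R n k -> R) (p : control_space R n k) : R :=
  derive1 (fun z => G (p.1, z)) p.2.

(* Main.v *)
Require Import Defs.
From mathcomp Require Import all_boot all_order all_algebra.
From mathcomp Require Import all_classical all_reals all_analysis.
From mathcomp Require Import ring.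

Set Implicit Arguments.
Unset Strict Implicit.
Unset Printing Implicit Defensive.

Import Order.TTheory GRing.Theory Num.Theory.
Import numFieldNormedType.Exports.

Local Open Scope classical_set_scope.
Local Open Scope ring_scope.

(** The extended Lagrangian is affine in the velocities, with [xdot^i] having
    coefficient [mu_i] and [udot], [mudot] absent. So the momenta along a curve
    are [mu_i], [0] and [0]: the Herglotz equation of [mu_i] is the control
    equation, that of [u^a] is the algebraic constraint, and that of [x^i] is
    the adjoint equation. The control equation makes the constraint terms of
    the Lagrangian vanish, so that [zdot] equals [F]. *)

(** * Directional derivatives along lines *)

(** The difference quotient sees only the values on one line, so the ambient space may change. This
    transfers derivatives between the [row_mx] coordinates of the configuration space and the
    product [control_space]. *)
Lemma eq_derive_line (R : realType) (V V' W : normedModType R)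
    (f : V -> W) (g : V' -> W) (a v : V) (b w : V') :
  (forall h : R, f (h *: v + a) = g (h *: w + b)) -> 'D_v f a = 'D_w g b.
Proof.
move=> fg; have fgab : f a = g b by have := fg 0; rewrite !scale0r !add0r.
rewrite /derive; set dg := fun h : R => h^-1 *: ((g \o _) _ - _).
by under eq_fun do rewrite /= fg fgab.
Qed.

(** The difference quotient equals [c] for every nonzero [h]. This serves the variables in which the
    Lagrangian is affine: velocities and multipliers. *)
Lemma derive_affine_line (R : realType) (V W : normedModType R)
    (f : V -> W) (a v : V) (c : W) :
  (forall h : R, f (h *: v + a) = f a + h *: c) -> 'D_v f a = c.
Proof.
move=> fE; apply: cvg_lim; first exact: norm_hausdorff.
apply: cvg_near_cst.
near=> h.
have h0 : h != 0 by near: h; exact: nbhs_dnbhs_neq.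
by rewrite /= fE [f a + _]addrC addrK scalerA mulVf// scale1r.
Unshelve. all: by end_near. Qed.

Lemma smooth_on_differentiable (R : realType) (V W : normedModType R)
    (U : set V) (f : V -> W) (p : V) :
  smooth_on U f -> U p -> differentiable f p.
Proof. by move=> /(_ 1%N)[+ _]; exact. Qed.

(** The open neighbourhood contains [t] even when [t] is an endpoint of [I], so the derivative is
    two-sided. *)
Lemma smooth_curve_derivable (R : realType) (V : normedModType R)
    (I : interval R) (c : R -> V) (t : R) :
  smooth_curve I c -> t \in I -> derivable c t 1.
Proof.
move=> [D [_ ID cD]] tI; apply: diff_derivable.
exact: (smooth_on_differentiable cD (ID _ tI)).
Qed.

(** * Entrywise and blockwise differentiation of matrix-valued curves *)

Lemma derivable_entry (R : realType) (V : normedModType R) (m n : nat)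
    (M : V -> 'M[R]_(m, n)) (p v : V) i j :
  derivable M p v -> derivable (fun q => M q i j) p v.
Proof. by move=> /derivable_mxP; exact. Qed.

Lemma derive1_entry (R : realType) (m n : nat) (M : R -> 'M[R]_(m, n))
    (t : R) i j :
  derivable M t 1 -> derive1 (fun s => M s i j) t = derive1 M t i j.
Proof. by move=> dM; rewrite !derive1E derive_mx// mxE. Qed.

Lemma derivable_row_mx (R : realType) (m n1 n2 : nat)
    (A : R -> 'M[R]_(m, n1)) (B : R -> 'M[R]_(m, n2)) (t v : R) :
  derivable A t v -> derivable B t v ->
  derivable (fun s => row_mx (A s) (B s)) t v.
Proof.
move=> dA dB; apply/derivable_mxP => i j; case: (split_ordP j) => k ->.
- by under eq_fun do rewrite row_mxEl; exact: derivable_entry.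
- by under eq_fun do rewrite row_mxEr; exact: derivable_entry.
Qed.

Lemma derive1_row_mx (R : realType) (m n1 n2 : nat)
    (A : R -> 'M[R]_(m, n1)) (B : R -> 'M[R]_(m, n2)) (t : R) :
  derivable A t 1 -> derivable B t 1 ->
  derive1 (fun s => row_mx (A s) (B s)) t = row_mx (derive1 A t) (derive1 B t).
Proof.
move=> dA dB; apply/matrixP => i j.
rewrite -derive1_entry; last exact: derivable_row_mx.
case: (split_ordP j) => k ->.
- by under eq_fun do rewrite row_mxEl; rewrite row_mxEl derive1_entry.
- by under eq_fun do rewrite row_mxEr; rewrite row_mxEr derive1_entry.
Qed.

(** * Partial derivatives on the control space and the extended Lagrangian as a function there *)

Section ControlSpace.
Variables (R : realType) (n k : nat).
Implicit Types (G F : control_space R n k -> R) (p : control_space R n k).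

Lemma dxE G p i : dx i G p = 'D_((delta_mx 0 i, 0), 0) G p.
Proof.
case: p => [[a b] c]; apply: eq_derive_line => h /=.
(* Operations on triples compute componentwise by conversion; stating the unfolded triple lets the
   zero components be rewritten away. *)
transitivity (G (h *: delta_mx 0 i + a, h *: 0 + b, h *: 0 + c)); last by [].
by rewrite !scaler0 !add0r.
Qed.

Lemma duE G p i : du i G p = 'D_((0, delta_mx 0 i), 0) G p.
Proof.
case: p => [[a b] c]; apply: eq_derive_line => h /=.
transitivity (G (h *: 0 + a, h *: delta_mx 0 i + b, h *: 0 + c)); last by [].
by rewrite !scaler0 !add0r.
Qed.

Lemma dzE G p : dz G p = 'D_((0, 0), 1) G p.
Proof.
case: p => [[a b] c]; rewrite /dz derive1E; apply: eq_derive_line => h /=.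
transitivity (G (h *: 0 + a, h *: 0 + b, h *: 1 + c)); last by [].
by rewrite !scaler0 !add0r.
Qed.

(** With the Pontryagin Hamiltonian $H = m_j X^j - F$, this is $m_j v^j - H$. Multiplier and
    velocity are parameters, so that differentiation in [p] covers $x$, $u$ and $z$ uniformly. *)
Definition control_hamiltonian (X : control_space R n k -> 'rV[R]_n) F
    (m v : 'rV[R]_n) p : R :=
  F p - \sum_(j < n) m 0 j * (X p 0 j - v 0 j).

Lemma derive_control_hamiltonian X F m v p w :
  differentiable X p -> differentiable F p ->
  'D_w (control_hamiltonian X F m v) p =
    'D_w F p - \sum_(j < n) m 0 j * 'D_w (fun q => X q 0 j) p.
Proof.
move=> diffX diffF.
have dX : derivable X p w by exact: diff_derivable.
have dF : derivable F p w by exact: diff_derivable.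
have dXj j : derivable (fun q => X q 0 j) p w by exact: derivable_entry.
have dXv j : derivable ((fun q => X q 0 j) - cst (v 0 j)) p w.
  exact: derivableB.
(* The pointfree form exposes the sums and scalings to the derivation rules; [v] enters as a
   constant and its derivative vanishes. *)
have -> : control_hamiltonian X F m v =
    F - \sum_(j < n) m 0 j \*: ((fun q => X q 0 j) - cst (v 0 j)).
  apply/funext => q; rewrite /control_hamiltonian !fctE.
  by rewrite fct_sumE.
rewrite deriveB//; last by apply: derivable_sum => j; exact: derivableZ.
rewrite derive_sum; last by move=> j; exact: derivableZ.
congr (_ - _); apply: eq_bigr => j _.
by rewrite deriveZ// deriveB// derive_cst subr0.
Qed.

(** Of the three velocity blocks only the first, $\dot x$, survives the projections. *)
Lemma control_extended_lagrangianE X F a b m (v : 'rV[R]_(n + k + n)) s :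
  control_extended_lagrangian X F (row_mx (row_mx a b) m) v s =
    control_hamiltonian X F m (lsubmx (lsubmx v)) (a, b, s).
Proof.
rewrite /control_extended_lagrangian /extended_lagrangian /control_lagrangian.
rewrite !row_mxKl !row_mxKr; congr (_ - _); apply: eq_bigr => j _.
by rewrite /control_constraint !row_mxKl !row_mxKr !mxE.
Qed.

Lemma control_hamiltonian_affine_velocity X F m v w p (h : R) :
  control_hamiltonian X F m (h *: w + v) p =
    control_hamiltonian X F m v p + h *: \sum_(j < n) m 0 j * w 0 j.
Proof.
rewrite /control_hamiltonian -addrA scaler_sumr -sumrN -[in RHS]sumrN.
rewrite -big_split/=; congr (_ + _); apply: eq_bigr => j _.
by rewrite !mxE /GRing.scale/=; ring.
Qed.

Lemma control_hamiltonian_affine_multiplier X F m w v p (h : R) :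
  control_hamiltonian X F (h *: w + m) v p =
    control_hamiltonian X F m v p
      + h *: - \sum_(j < n) w 0 j * (X p 0 j - v 0 j).
Proof.
rewrite /control_hamiltonian -addrA -!sumrN scaler_sumr.
rewrite -big_split/=; congr (_ + _); apply: eq_bigr => j _.
by rewrite !mxE /GRing.scale/=; ring.
Qed.

(** * Momenta and partial derivatives along a curve *)

Section AlongCurve.
Variables (X : control_space R n k -> 'rV[R]_n) (F : control_space R n k -> R).
Variables (x : R -> 'rV[R]_n) (u : R -> 'rV[R]_k) (mu : R -> 'rV[R]_n).
Variable (z : R -> R).

Let y := extended_curve x u mu.
Let L := control_extended_lagrangian X F.
Let Xc j := fun p => X p 0 j.

(** The momentum is the slope of an affine function of the velocity: the pairing of [mu t] with the
    $\dot x$ block of the basis vector of index [A]. The three block positions of [A] then give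
    $\mu_i$, $0$ and $0$. *)
Lemma momentum_control A t :
  momentum L y z A t =
    \sum_(j < n) mu t 0 j * lsubmx (lsubmx (delta_mx 0 A : 'rV_(n + k + n))) 0 j.
Proof.
apply: derive_affine_line => h.
rewrite /L /y /extended_curve !control_extended_lagrangianE !linearP.
by rewrite control_hamiltonian_affine_velocity.
Qed.

Lemma momentum_state i t :
  momentum L y z (lshift n (lshift k i)) t = mu t 0 i.
Proof.
rewrite momentum_control !delta_mx_lshift !row_mxKl (bigD1 i)//= big1.
  by rewrite mxE !eqxx mulr1 addr0.
by move=> j ji; rewrite mxE (negbTE ji) andbF mulr0.
Qed.

Lemma momentum_control_variable a t :
  momentum L y z (lshift n (rshift n a)) t = 0.
Proof.
rewrite momentum_control delta_mx_lshift delta_mx_rshift !row_mxKl.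
by rewrite big1// => j _; rewrite mxE mulr0.
Qed.

Lemma momentum_multiplier i t : momentum L y z (rshift (n + k) i) t = 0.
Proof.
rewrite momentum_control delta_mx_rshift row_mxKl.
by rewrite big1// => j _; rewrite !mxE mulr0.
Qed.

Variable t : R.
Hypotheses (dx_t : derivable x t 1) (du_t : derivable u t 1).
Hypothesis (dmu_t : derivable mu t 1).

Let p := (x t, u t, z t).

Lemma derive1_extended_curve :
  derive1 y t = row_mx (row_mx (derive1 x t) (derive1 u t)) (derive1 mu t).
Proof. by rewrite !derive1_row_mx//; exact: derivable_row_mx. Qed.

Lemma lagrangian_along_curve :
  L (y t) (derive1 y t) (z t) = control_hamiltonian X F (mu t) (derive1 x t) p.
Proof.
rewrite /L /y /extended_curve control_extended_lagrangianE.
by rewrite derive1_extended_curve !row_mxKl.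
Qed.

(** The Lagrangian is affine in the multiplier, with slope $-\psi^i$ in direction $\mu_i$. *)
Lemma partial_multiplier i :
  partial (rshift (n + k) i) (fun q => L q (derive1 y t) (z t)) (y t) =
    - (Xc i p - derive1 x t 0 i).
Proof.
apply: derive_affine_line => h.
rewrite delta_mx_rshift scale_row_mx add_row_mx scaler0 add0r.
rewrite /L /y /extended_curve !control_extended_lagrangianE.
rewrite control_hamiltonian_affine_multiplier.
rewrite derive1_extended_curve !row_mxKl (bigD1 i)//= big1.
  by rewrite mxE !eqxx mul1r addr0.
by move=> j ji; rewrite mxE (negbTE ji) andbF mul0r.
Qed.

Hypotheses (diffX : differentiable X p) (diffF : differentiable F p).

Lemma partial_state i :
  partial (lshift n (lshift k i)) (fun q => L q (derive1 y t) (z t)) (y t) =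
    dx i F p - \sum_(j < n) mu t 0 j * dx i (Xc j) p.
Proof.
rewrite dxE; under eq_bigr do rewrite dxE.
(* The right-hand side is reassembled into one partial derivative, with the velocity frozen at its
   value at [t]; it remains to compare two functions on a line. *)
rewrite -(derive_control_hamiltonian _ (derive1 x t))// -dxE.
apply: eq_derive_line => h.
rewrite !delta_mx_lshift !scale_row_mx !add_row_mx !scaler0 !add0r.
rewrite /L /y /extended_curve control_extended_lagrangianE.
by rewrite derive1_extended_curve !row_mxKl.
Qed.

Lemma partial_control_variable a :
  partial (lshift n (rshift n a)) (fun q => L q (derive1 y t) (z t)) (y t) =
    du a F p - \sum_(j < n) mu t 0 j * du a (Xc j) p.
Proof.
rewrite duE; under eq_bigr do rewrite duE.
rewrite -(derive_control_hamiltonian _ (derive1 x t))// -duE.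
apply: eq_derive_line => h.
rewrite delta_mx_lshift delta_mx_rshift !scale_row_mx !add_row_mx.
rewrite !scaler0 !add0r.
rewrite /L /y /extended_curve control_extended_lagrangianE.
by rewrite derive1_extended_curve !row_mxKl.
Qed.

Lemma derive1_lagrangian_action :
  derive1 (fun s => L (y t) (derive1 y t) s) (z t) =
    dz F p - \sum_(j < n) mu t 0 j * dz (Xc j) p.
Proof.
rewrite dzE; under eq_bigr do rewrite dzE.
rewrite -(derive_control_hamiltonian _ (derive1 x t))// -dzE /dz; congr (derive1 _ _).
apply/funext => s.
rewrite /L /y /extended_curve control_extended_lagrangianE.
by rewrite derive1_extended_curve !row_mxKl.
Qed.

Lemma herglotz_control_equations :
  herglotz_equations L y z t <->
  [/\ forall i, derive1 x t 0 i = Xc i p,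
      forall i, derive1 mu t 0 i
          - (dx i F p - \sum_(j < n) mu t 0 j * dx i (Xc j) p) =
        mu t 0 i * (dz F p - \sum_(j < n) mu t 0 j * dz (Xc j) p)
    & forall a, du a F p - \sum_(j < n) mu t 0 j * du a (Xc j) p = 0].
Proof.
(* The momentum formulas hold at every time, hence are equalities of functions of time and can be
   differentiated. *)
have momE i : derive1 (momentum L y z (lshift n (lshift k i))) t =
    derive1 mu t 0 i.
  by rewrite -derive1_entry//; congr (derive1 _ _); apply/funext => s;
    rewrite momentum_state.
have momuE a : derive1 (momentum L y z (lshift n (rshift n a))) t = 0.
  rewrite [X in derive1 X](_ : _ = cst 0) ?derive1_cst//.
  by apply/funext => s; rewrite momentum_control_variable.
have mommuE i : derive1 (momentum L y z (rshift (n + k) i)) t = 0.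
  rewrite [X in derive1 X](_ : _ = cst 0) ?derive1_cst//.
  by apply/funext => s; rewrite momentum_multiplier.
(* For the converse, the index [A] is split into the blocks of $x$, $u$ and $\mu$, each served by
   one hypothesis. *)
split=> [H|[Hx Hmu Hu] A]; last first.
  case: (split_ordP A) => [B ->|i ->].
    case: (split_ordP B) => [i ->|a ->].
      by rewrite momE partial_state momentum_state derive1_lagrangian_action.
    rewrite momuE partial_control_variable momentum_control_variable Hu.
    by rewrite subr0 mul0r.
  rewrite mommuE partial_multiplier momentum_multiplier Hx.
  by rewrite subrr oppr0 subr0 mul0r.
split=> [i|i|a].
(* With zero momentum the equation of $\mu_i$ reduces to $X^i - \dot x^i = 0$. *)
- have := H (rshift (n + k) i).
  rewrite mommuE partial_multiplier momentum_multiplier mul0r sub0r opprK.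
  by move/eqP; rewrite subr_eq0 => /eqP ->.
- have := H (lshift n (lshift k i)).
  by rewrite momE partial_state momentum_state derive1_lagrangian_action.
- have := H (lshift n (rshift n a)).
  rewrite momuE partial_control_variable momentum_control_variable mul0r sub0r.
  by move/eqP; rewrite oppr_eq0 => /eqP.
Qed.

End AlongCurve.
End ControlSpace.

(** * The equivalence over the whole interval *)

Theorem mainTheorem4 (R : realType) (n k : nat)
    (U : set (control_space R n k)) (openU : open U)
    (X : control_space R n k -> 'rV[R]_n) (F : control_space R n k -> R)
    (smoothX : smooth_on U X) (smoothF : smooth_on U F)
    (I : interval R)
    (x : R -> 'rV[R]_n) (u : R -> 'rV[R]_k) (mu : R -> 'rV[R]_n) (z : R -> R)
    (smoothx : smooth_curve I x) (smoothu : smooth_curve I u)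
    (smoothmu : smooth_curve I mu) (smoothz : smooth_curve I z)
    (inU : forall t, t \in I -> U (x t, u t, z t)) :
  let y := extended_curve x u mu in
  let L := control_extended_lagrangian X F in
  let Xc j := fun p => X p 0 j in
  (forall t, t \in I ->
     herglotz_equations L y z t /\
     derive1 z t = L (y t) (derive1 y t) (z t))
  <->
  (forall t, t \in I ->
     let p := (x t, u t, z t) in
     [/\ forall i, (derive1 x t) 0 i = Xc i p,
         forall i, (derive1 mu t) 0 i =
           mu t 0 i * dz F p
           - \sum_(j < n) mu t 0 j * dx i (Xc j) p
           + dx i F p
           - \sum_(j < n) dz (Xc j) p * mu t 0 i * mu t 0 j,
         derive1 z t = F p
       & forall a, du a F p - \sum_(j < n) mu t 0 j * du a (Xc j) p = 0]).
Proof.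
move=> y L Xc.
have dx_I t tI := smooth_curve_derivable (t := t) smoothx tI.
have du_I t tI := smooth_curve_derivable (t := t) smoothu tI.
have dmu_I t tI := smooth_curve_derivable (t := t) smoothmu tI.
have equationsE t (tI : t \in I) := herglotz_control_equations
  (dx_I t tI) (du_I t tI) (dmu_I t tI)
  (smooth_on_differentiable smoothX (inU t tI))
  (smooth_on_differentiable smoothF (inU t tI)).
have LE t (tI : t \in I) :=
  lagrangian_along_curve X F z (dx_I t tI) (du_I t tI) (dmu_I t tI).
(* The term quadratic in $\mu$ comes from the momentum $\mu_i$ multiplying the constraint part of
   $\partial\mathcal{L}/\partial z$. *)
have quadraticE t i p : \sum_(j < n) dz (Xc j) p * mu t 0 i * mu t 0 j =
    mu t 0 i * \sum_(j < n) mu t 0 j * dz (Xc j) p.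
  by rewrite mulr_sumr; apply: eq_bigr => j _; ring.
(* Both systems contain $\dot x^i = X^i$, so this exchanges $\dot z = \mathcal{L}$ and $\dot z = F$
   in either direction. *)
have onshellE t p : (forall i, derive1 x t 0 i = Xc i p) ->
    control_hamiltonian X F (mu t) (derive1 x t) p = F p.
  move=> xE; rewrite /control_hamiltonian big1 ?subr0// => j _.
  by rewrite xE subrr mulr0.
split=> H t tI.
- have [/(equationsE _ tI)[xE muE uE] zE] := H t tI.
  split=> //; last by rewrite zE /L /y LE// onshellE.
  (* The adjoint equation is the Herglotz equation of $x^i$ solved for $\dot\mu_i$. *)
  move=> i; rewrite quadraticE.
  by move/eqP: (muE i); rewrite subr_eq => /eqP ->; ring.
- have [xE muE zE uE] := H t tI.
  split; last by rewrite zE /L /y LE// onshellE.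
  by apply/(equationsE _ tI); split=> // i; rewrite muE quadraticE; ring.
Qed.
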